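(* Let $X$ be a non-degenerate totally regular continuum endowed with a convex metric $d$ such that $\mathcal H^1_d(X)<\infty$. Let $f:X\to X$ be a $P$-Lipschitz map with respect to a splitting $\mathcal A$ and positive constants $(L_A)_{A\in\mathcal A}$. Then, for every nonempty subsystem $\mathcal B\subseteq\mathcal A$, $$h(f)\le \log^+ L_{\mathcal B}+2\theta_{\mathcal B}\log^+ L_{\mathcal A}.$$
   Context: A continuum is a connected compact (nonempty) metric space. A continuum $X$ is totally regular if for every $x\in X$ and every countable $P\subseteq X$ there is a basis of neighborhoods of $x$ with finite boundary not intersecting $P$. A metric $d$ on $X$ is convex if for all distinct $x,y\in X$ there is $z\in X$ with $d(x,z)=d(z,y)=d(x,y)/2$. $\mathcal H^1_d$ is the one-dimensional Hausdorff measure of $(X,d)$, and $h(f)$ is topological entropy. A splitting of a continuum $X$ is a finite system $\mathcal A=\{X_1,\dots,X_n\}$ of non-degenerate subcontinua covering $X$ such that $P_{\mathcal A}=\bigcup_{i\ne j}X_i\cap X_j$ is finite. Let $f:X\to X$ be continuous, $P$ a finite subset of $X$ with $f(P)\subseteq P$, $\mathcal A$ a splitting of $X$ with $P_{\mathcal A}\subseteq P$, and $(L_A)_{A\in\mathcal A}$ positive constants. The map $f$ is $P$-Lipschitz w.r.t. $\mathcal A$ and $(L_A)_{A\in\mathcal A}$ if for every $A\in\mathcal A$ the set $f(A)$ is non-degenerate and the restriction $f|_A$ is Lipschitz (w.r.t. $d$) with constant at most $L_A$. For $A,B\in\mathcal A$ write $A\to B$ if $f(A)$ intersects the interior of $B$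 (in $X$). For $n\ge1$ let $\mathcal A^n$ be the set of all $(A_0,\dots,A_{n-1})$ with $A_i\in\mathcal A$ and $A_0\to A_1\to\dots\to A_{n-1}$. For nonempty $\mathcal B\subseteq\mathcal A$ put $L_{\mathcal B}=\max_{A\in\mathcal B}L_A$ and $$\theta_{\mathcal B}=\limsup_{n\to\infty}\frac{k_n^{\mathcal B}}{n},\qquad k_n^{\mathcal B}=\max_{(A_0,\dots,A_{n-1})\in\mathcal A^n}\#\{k\in\{0,\dots,n-1\}:A_k\notin\mathcal B\}.$$ Finally $\log^+L=\max\{\log L,0\}$. *)

(* Defs.v *)
From HB Require Import structures.
From mathcomp Require Import all_boot all_order all_algebra.
From mathcomp Require Import all_classical all_reals all_analysis.

Set Implicit Arguments.
Unset Strict Implicit.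
Unset Printing Implicit Defensive.

Import Order.TTheory GRing.Theory Num.Theory.
Import numFieldNormedType.Exports.

Local Open Scope classical_set_scope.
Local Open Scope ring_scope.

Section continua.
Context {R : realType} {X : metricType R}.
Implicit Types (x y z : X) (A P U V : set X).

Definition nondegenerate_set A := exists x y, [/\ A x, A y & x <> y].

(* Compactness and connectedness of a subset are those of the subspace, so
   [continuum A] with [A : set X] also describes the subcontinua of [X]. *)
Definition continuum A := [/\ A !=set0, compact A & connected A].

Definition boundary A : set X := closure A `\` A°.

Definition nbhs_basis x (B : set (set X)) :=
  (forall V, B V -> nbhs x V) /\
  (forall U, nbhs x U -> exists2 V, B V & V `<=` U).

Definition totally_regular :=
  forall x P, countable P -> exists2 B : set (set X), nbhs_basis x B &
    forall V, B V -> finite_set (boundary V) /\ boundary V `&` P = set0.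

Definition convex_metric :=
  forall x y, x <> y -> exists z,
    mdist x z = mdist x y / 2 /\ mdist z y = mdist x y / 2.

End continua.

Arguments totally_regular {R} X.
Arguments convex_metric {R} X.

Section hausdorff_measure.
Context {R : realType} {X : metricType R}.
Implicit Types A : set X.
Local Open Scope ereal_scope.

(* The [maxe] only matters for [set0], whose supremum would be [-oo]. *)
Definition diam A : \bar R :=
  maxe 0 (ereal_sup [set (mdist x y)%:E | x in A & y in A]).

(* Members of a cover may be empty, so finite covers are included. *)
Definition hausdorff1_pre (delta : R) A : \bar R :=
  ereal_inf [set \sum_(0 <= i <oo) diam (U i) | U in
    [set U : nat -> set X |
      A `<=` \bigcup_i U i /\ forall i, diam (U i) <= delta%:E]].

(* The limit exists: [hausdorff1_pre delta A] is nonincreasing in [delta]. *)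
Definition hausdorff1 A : \bar R :=
  lim (hausdorff1_pre delta A @[delta --> (0 : R)^'+]).

End hausdorff_measure.

Section topological_entropy.
Context {R : realType} {X : metricType R}.
Variable f : X -> X.

Definition bowen_dist (n : nat) (x y : X) : R :=
  \big[Num.max/0]_(k < n) mdist (iter k f x) (iter k f y).

Definition separated_seq (n : nat) (e : R) (s : seq X) :=
  uniq s /\ {in s &, forall x y, x != y -> e < bowen_dist n x y}.

Definition max_separated (n : nat) (e : R) : \bar R :=
  ereal_sup [set ((size s)%:R)%:E | s in separated_seq n e].

(* Bowen's definition; the limit exists because the growth rate is
   nonincreasing in [e]. *)
Definition topological_entropy : \bar R :=
  lim (limn_esup (fun n => (lne (max_separated n e) * (n%:R^-1)%:E)%E)
       @[e --> (0 : R)^'+]).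

End topological_entropy.

Section splittings.
Context {R : realType} {X : metricType R}.
Variables (N : nat) (A : 'I_N -> set X).
Implicit Types (f : X -> X) (P : set X) (L : 'I_N -> R) (B : {set 'I_N}).

Definition splitting_points : set X :=
  [set x | exists i j : 'I_N, i != j /\ (A i `&` A j) x].

(* A splitting is presented as a family; it is automatically injective, because
   a non-degenerate continuum is infinite and the pairwise intersections are
   finite. *)
Definition splitting :=
  [/\ forall i, continuum (A i) /\ nondegenerate_set (A i),
      \bigcup_i A i = setT &
      finite_set splitting_points].

Record P_Lipschitz f P L : Prop := {
  P_Lipschitz_continuous : continuous f ;
  P_Lipschitz_finite : finite_set P ;
  P_Lipschitz_invariant : f @` P `<=` P ;
  P_Lipschitz_splitting : splitting ;
  P_Lipschitz_splitting_points : splitting_points `<=` P ;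
  P_Lipschitz_pos : forall i, 0 < L i ;
  P_Lipschitz_nondegenerate : forall i, nondegenerate_set (f @` A i) ;
  P_Lipschitz_lipschitz : forall i x y, A i x -> A i y ->
    mdist (f x) (f y) <= L i * mdist x y
}.

Definition transition f (i j : 'I_N) : bool :=
  `[< f @` A i `&` (A j)° !=set0 >].

Definition itineraries f (n : nat) : {set n.-tuple 'I_N} :=
  [set s : n.-tuple 'I_N | sorted (transition f) s]%SET.

Definition max_visits_outside f B (n : nat) : nat :=
  \max_(s in itineraries f n) #|[set k : 'I_n | tnth s k \notin B]%SET|.

Definition theta f B : \bar R :=
  limn_esup (fun n => ((max_visits_outside f B n)%:R / n%:R)%:E).

(* The default value 0 is harmless: [L] is positive and [B] nonempty. *)
Definition max_const L B : R := \big[Num.max/0]_(i in B) L i.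

End splittings.

Definition ln_plus {R : realType} (x : R) : R := Num.max (ln x) 0.

(* Main.v *)
(* The iterate [f^n] is globally Lipschitz with constant
     [Lam_n = max(1, L_B)^n * max(1, L_A)^(k_n)].
   Away from the orbits that hit [P], [f^n] is locally a composite of [n]
   restrictions [f|A_0, ..., f|A_(n-1)] along an itinerary, hence locally
   [Lam_n]-Lipschitz; the remaining points are mapped by [f^n] into the finite
   invariant set [P] and do not contribute, by flattening the distance function
   near [P].  Compactness and midpoints make the local bound global.  Since [X]
   is connected of finite length, an [r]-separated set has at most [1 + C / r]
   points, so an (n, e)-separated set has [O(max_(k < n) Lam_k)] points.  This
   gives [h(f) <= log^+ L_B + theta_B log^+ L_A]. *)

Require Import Defs.
From HB Require Import structures.
From mathcomp Require Import all_boot all_order all_algebra.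
From mathcomp Require Import all_classical all_reals all_analysis.
From mathcomp Require Import ring lra.

Set Implicit Arguments.
Unset Strict Implicit.
Unset Printing Implicit Defensive.

Import Order.TTheory GRing.Theory Num.Theory.
Import numFieldNormedType.Exports.

Local Open Scope classical_set_scope.
Local Open Scope ring_scope.

(** * Local-to-global Lipschitz bounds and flattened distance functions *)

Section lipschitz.
Context {R : realType} {X : metricType R}.
Implicit Types (x y z p : X) (u : X -> R) (lam : R).

Definition locally_lipschitz_at lam u x :=
  \forall y \near x & z \near x, `|u y - u z| <= lam * mdist y z.

Lemma mdist_nbhsP x (U : set X) :
  nbhs x U <-> exists2 r : R, 0 < r & forall y, mdist x y < r -> U y.
Proof.
split=> [/nbhs_ballP[r /= r0 rU]|[r r0 rU]].
  by exists r => // y xy; apply: rU; rewrite ballEmdist.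
by apply/nbhs_ballP; exists r => //= y; rewrite ballEmdist => /rU.
Qed.

(** The admissible scale doubles at each induction step: a midpoint halves the distance, and the
    bounds on the two halves add up with no loss in [lam]. *)
Lemma convex_metric_lipschitz lam u (delta : R) : convex_metric X -> 0 < delta ->
  (forall x y, mdist x y < delta -> `|u x - u y| <= lam * mdist x y) ->
  forall x y, `|u x - u y| <= lam * mdist x y.
Proof.
move=> cX delta0 udelta x y.
have H k : forall x y, mdist x y < 2 ^+ k * delta ->
    `|u x - u y| <= lam * mdist x y.
  elim: k => [|k IHk] {}x {}y; first by rewrite expr0 mul1r; exact: udelta.
  rewrite exprS => xy; have [->|/eqP/cX[z [xz zy]]] := eqVneq x y.
    by rewrite mdistxx subrr normr0 mulr0.
  have h1 : `|u x - u z| <= lam * mdist x z by apply: IHk; rewrite xz; lra.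
  have h2 : `|u z - u y| <= lam * mdist z y by apply: IHk; rewrite zy; lra.
  have := ler_distD (u z) (u x) (u y).
  by rewrite xz in h1; rewrite zy in h2; lra.
pose k := Num.bound (mdist x y / delta).
apply: (H k); rewrite -ltr_pdivrMr//.
apply: (@lt_trans _ _ k%:R).
  by rewrite archi_boundP// divr_ge0 ?mdist_ge0// ltW.
by rewrite -natrX ltr_nat ltn_expl.
Qed.

(** A Lebesgue number argument: [delta] is a radius that serves all points at once. *)
Lemma compact_locally_lipschitz lam u : compact [set: X] ->
  (forall x, locally_lipschitz_at lam u x) ->
  exists2 delta : R, 0 < delta &
    forall x y, mdist x y < delta -> `|u x - u y| <= lam * mdist x y.
Proof.
move=> /compact_near_coveringP cX ulip.
pose Q (e : R) x := forall y, mdist x y < e -> `|u x - u y| <= lam * mdist x y.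
have : \forall e \near (0 : R)^'+, [set: X] `<=` Q e.
  apply: cX => x _; have [[U V] [/= Ux Vx] UV] := ulip x.
  have /mdist_nbhsP[r r0 rUV] : nbhs x (U `&` V) by exact: filterI.
  exists (ball x (r / 2), [set e | e < r / 2]).
    split=> /=; last by apply: nbhs_right_lt; lra.
    by apply: nbhsx_ballx; rewrite divr_gt0.
  move=> [y e] /= []; rewrite ballEmdist /= => xy er z yz.
  apply: (UV (y, z)); split => /=.
    by have [] : (U `&` V) y by apply: rUV; lra.
  have [] // : (U `&` V) z.
  by apply: rUV; have := metric_triangle x y z; lra.
move=> [e /= e0 he]; exists (e / 2); first lra.
move=> x y; apply: (he (e / 2)) => //=; last lra.
by rewrite sub0r normrN gtr0_norm; lra.
Qed.

(** Each point [p] of [F] is treated by composing with a 1-Lipschitz real function that is constant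
    on an interval around [u p]. Constancy near the points already treated survives, since the new
    function factors through the old one. *)
Lemma flattened_distance (F : seq X) x (eta : R) : 0 < eta ->
  exists u, [/\ forall y z, `|u y - u z| <= mdist y z,
    forall y, `|u y - mdist x y| <= eta &
    forall p, p \in F -> \forall y \near p, u y = u p].
Proof.
elim: F eta => [|p F IHF] eta eta0.
  exists (mdist x); split => // [y z|y]; last by rewrite subrr normr0 ltW.
  have := metric_triangle x y z; have := metric_triangle x z y.
  by rewrite (metric_sym z y) ler_norml => *; apply/andP; split; lra.
(* One [h] is the error of the induction hypothesis, the other the shift caused by the new plateau
   of half-width [h]. *)
have [h h0 ->] : exists2 h, 0 < h & eta = h + h by exists (eta / 2); lra.
have [u [u1 ux uF]] := IHF h h0.
pose v y :=
  if u y <= u p - h then u y + h else if u y <= u p + h then u p else u y - h.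
exists v; split => [y z|y|q].
- have := u1 y z; rewrite /v !ler_norml => /andP[? ?].
  by apply/andP; split; repeat (case: ifPn; rewrite -?ltNge => ?); lra.
- have := ux y; rewrite /v !ler_norml => /andP[? ?].
  by apply/andP; split; repeat (case: ifPn; rewrite -?ltNge => ?); lra.
rewrite inE => /predU1P[->|/uF qF]; last first.
  by near=> y; rewrite /v (_ : u y = u q)//; near: y.
apply/mdist_nbhsP; exists h => // y py.
have : `|u y - u p| < h by apply: le_lt_trans (u1 _ _) _; rewrite metric_sym.
rewrite ltr_norml /v => /andP[? ?].
by repeat (case: ifPn; rewrite -?ltNge => ?); lra.
Unshelve. all: by end_near. Qed.

End lipschitz.

(** * Lipschitz constants of the iterates *)

Section lipschitz_iterates.
Context {R : realType} {X : metricType R}.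
Hypotheses (cptX : compact [set: X]) (convX : convex_metric X).

(* Composing with a real function that is constant near each point of [P] turns
   the exceptional points into points where the composite is constant. *)
Lemma lipschitz_off_finite (P : set X) (g : X -> X) (lam : R) :
  finite_set P -> continuous g -> 0 <= lam ->
  (forall x, ~ P (g x) -> \forall y \near x & z \near x,
    mdist (g y) (g z) <= lam * mdist y z) ->
  forall x y, mdist (g x) (g y) <= lam * mdist x y.
Proof.
move=> /finite_seqP[F PF] cg lam0 glip x y; apply/ler_addgt0Pr => e e0.
(* The error [e / 2] is met twice, at [g x] and at [g y]. *)
have [|u [u1 ux uF]] := @flattened_distance R X F (g x) (e / 2); first lra.
have [||delta delta0 ud] := @compact_locally_lipschitz R X lam (u \o g).
- exact: cptX.
- move=> z; have [Pgz|nPgz] := pselect (P (g z)).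
    have /cg ugz : \forall w \near g z, u w = u (g z).
      by apply: uF; move: Pgz; rewrite PF.
    exists ([set w | u (g w) = u (g z)], [set w | u (g w) = u (g z)]) => //=.
    move=> [w1 w2] /= [-> ->]; rewrite subrr normr0 mulr_ge0//.
    exact: mdist_ge0.
  apply: filterS (glip _ nPgz) => -[w1 w2] /=.
  exact/le_trans/u1.
have := convex_metric_lipschitz convX delta0 ud x y.
have := ux (g x); have := ux (g y); rewrite mdistxx /= !ler_norml.
by move=> /andP[? ?] /andP[? ?] /andP[? ?]; lra.
Qed.

Section splitting.
Context (N : nat) (A : 'I_N -> set X) (L : 'I_N -> R) (P : set X) (f : X -> X).
Hypothesis fP : P_Lipschitz A f P L.

(** The other pieces are closed, finite in number and miss [x], because a common point would lie in
    [P]. So only [A i] can cover a neighborhood of [x]. *)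
Lemma splitting_nbhs x i : ~ P x -> A i x -> nbhs x (A i).
Proof.
move=> nPx Aix.
have [/(_ _)/proj1 cA /seteqP[_ covA] _] := P_Lipschitz_splitting fP.
have : \forall y \near x, forall j, j != i -> ~ A j y.
  apply: filter_forall => j; have [->|ji] := eqVneq j i; first exact: nearW.
  have : open (~` A j).
    apply: closed_openC; apply: compact_closed; first exact: metric_hausdorff.
    by case: (cA j).
  move=> oA; have : nbhs x (~` A j).
    apply: open_nbhs_nbhs; split=> // Ajx; apply: nPx.
    by apply: (P_Lipschitz_splitting_points fP); exists j, i.
  by apply: filterS => y ? _.
apply: filterS => y Ay; have [j _ Ajy] := covA y I.
by have [<-//|ji] := eqVneq j i; have := Ay _ ji.
Qed.

Lemma continuous_iter_P_Lipschitz n : continuous (iter n f).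
Proof.
elim: n => [|n IHn] x /=; first exact: cvg_id.
apply: (@continuous_comp _ _ _ (iter n f) f); first exact: IHn.
exact: (P_Lipschitz_continuous fP).
Qed.

Lemma iter_P_Lipschitz n x : P x -> P (iter n f x).
Proof.
elim: n => //= n IHn Px; apply: (P_Lipschitz_invariant fP).
by exists (iter n f x) => //; exact: IHn.
Qed.

Lemma max_const_ge (B : {set 'I_N}) i : i \in B -> L i <= max_const L B.
Proof. by move=> iB; rewrite /max_const; exact: (le_bigmax_cond _ L). Qed.

Definition itinerary_const (B : {set 'I_N}) n : R :=
  Num.max 1 (max_const L B) ^+ n *
  Num.max 1 (max_const L [set: 'I_N]%SET) ^+ max_visits_outside A f B n.

(** Every step is charged a factor [b], and a step outside [B] also a factor [a]. As both are at
    least 1, the extra [b] does no harm and the number of factors [a] may be raised to its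
    maximum. *)
Lemma prod_itinerary_le (B : {set 'I_N}) n (s : n.-tuple 'I_N) :
  s \in itineraries A f n -> \prod_(k < n) L (tnth s k) <= itinerary_const B n.
Proof.
move=> sA; rewrite /itinerary_const.
set b := Num.max 1 (max_const L B); set a := Num.max 1 _.
have b1 : 1 <= b by rewrite le_max lexx.
have a1 : 1 <= a by rewrite le_max lexx.
apply: (@le_trans _ _
    (\prod_(k < n) (b * (if tnth s k \notin B then a else 1)))).
  apply: ler_prod => k _; rewrite (ltW (P_Lipschitz_pos fP _))/=.
  case: ifPn => [_|/negPn kB].
    apply: (@le_trans _ _ a); last by rewrite ler_peMl// (le_trans _ a1).
    by rewrite le_max max_const_ge ?orbT// in_setT.
  by rewrite mulr1 le_max max_const_ge ?orbT.
rewrite big_split/= prodr_const card_ord -big_mkcond/= prodr_const.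
rewrite ler_wpM2l ?exprn_ge0 ?(le_trans _ b1)//; apply: ler_weXn2l => //.
rewrite /max_visits_outside.
apply: leq_trans (leq_bigmax_cond _ sA).
by rewrite cardsE.
Qed.

Lemma iter_lipschitz (B : {set 'I_N}) n x y :
  mdist (iter n f x) (iter n f y) <= itinerary_const B n * mdist x y.
Proof.
have [_ /seteqP[_ covA] _] := P_Lipschitz_splitting fP.
have /choice[c Ac] : forall z, exists i, A i z.
  by move=> z; have [i _ ?] := covA z I; exists i.
apply: (@lipschitz_off_finite P) => [|||{}x nPx].
- exact: P_Lipschitz_finite fP.
- exact: continuous_iter_P_Lipschitz.
- by rewrite mulr_ge0// exprn_ge0// le_max ler01.
(* By invariance, an orbit that enters [P] stays there up to time [n]. *)
have nP k : (k <= n)%N -> ~ P (iter k f x).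
  move=> kn Pk; apply: nPx; rewrite -(subnK kn) iterD.
  exact: iter_P_Lipschitz.
pose i k := c (iter k f x).
have nA k : (k <= n)%N -> nbhs (iter k f x) (A (i k)).
  by move=> /nP nPk; exact: splitting_nbhs nPk (Ac _).
have Ai : \forall y \near x, forall k : 'I_n, A (i k) (iter k f y).
  apply: filter_forall => k; apply: continuous_iter_P_Lipschitz.
  exact/nA/ltnW.
pose s := [tuple i k | k < n].
(* The point [iter k.+1 f x] witnesses the transition: it is in the image of [A (i k)] and, being
   off [P], in the interior of [A (i k.+1)]. *)
have sA : s \in itineraries A f n.
  rewrite inE; apply/(sortedP (i 0)) => k; rewrite size_tuple => kn.
  have -> : nth (i 0) s k = i k := nth_mktuple _ _ (Ordinal (ltnW kn)).
  have -> : nth (i 0) s k.+1 = i k.+1 := nth_mktuple _ _ (Ordinal kn).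
  apply/asboolP; exists (iter k.+1 f x); split; last exact/nA/ltnW.
  by exists (iter k f x) => //; exact: Ac.
exists ([set y | forall k : 'I_n, A (i k) (iter k f y)],
        [set y | forall k : 'I_n, A (i k) (iter k f y)]) => //=.
move=> [{}y z] /= [Ay Az].
apply: (@le_trans _ _ (\prod_(k < n) L (tnth s k) * mdist y z)); last first.
  by rewrite ler_wpM2r ?mdist_ge0 ?prod_itinerary_le.
have -> : \prod_(k < n) L (tnth s k) = \prod_(k < n) L (i k).
  by apply: eq_bigr => k _; rewrite tnth_mktuple.
suff : forall m, (m <= n)%N ->
    mdist (iter m f y) (iter m f z) <= \prod_(k < m) L (i k) * mdist y z.
  exact.
elim=> [_|m IHm mn]; first by rewrite big_ord0 mul1r.
rewrite big_ord_recr /= [_ * L _]mulrC -mulrA.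
apply: le_trans (P_Lipschitz_lipschitz fP _ _) _.
- exact: (Ay (Ordinal mn)).
- exact: (Az (Ordinal mn)).
by rewrite ler_wpM2l ?(ltW (P_Lipschitz_pos fP _))// IHm// ltnW.
Qed.

End splitting.
End lipschitz_iterates.

(** * Packing bounds from finite length *)

Section packing.
Context {R : realType} {X : metricType R}.
Implicit Types (x y z p : X) (U : nat -> set X).

Lemma diam_ge0 (V : set X) : (0 <= diam V)%E.
Proof. by rewrite /diam le_max lexx. Qed.

Lemma mdist_le_diam (V : set X) x y : V x -> V y -> ((mdist x y)%:E <= diam V)%E.
Proof.
move=> Vx Vy; rewrite /diam le_max ereal_sup_ubound ?orbT//.
by exists x => //; exists y.
Qed.

Lemma hausdorff1_pre_le (V : set X) (delta : R) : 0 < delta ->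
  (hausdorff1_pre delta V <= hausdorff1 V)%E.
Proof.
move=> delta0.
have mono : {homo (hausdorff1_pre ^~ V) : d1 d2 / d1 <= d2 >-> (d2 <= d1)%E}.
  move=> d1 d2 d12; apply: le_ereal_inf => _ [U [UV Ud] <-]; exists U => //.
  by split=> // i; apply: le_trans (Ud i) _; rewrite lee_fin.
apply: lime_ge.
  apply: nonincreasing_at_right_is_cvge.
  by apply: nearW => x ? ? _ _; exact: mono.
by near=> d; apply: mono; near: d; exact: nbhs_right_le.
Unshelve. all: by end_near. Qed.

(* The distance to [p] maps the members of the cover onto sets covering
   [[0, r[]; the factor 2 saves finding the optimal interval around each. *)
Lemma length_cover_ball U (D : nat -> R) p q (r : R) : connected [set: X] ->
  r <= mdist p q -> [set: X] `<=` \bigcup_i U i ->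
  (forall i, 0 <= D i) -> (forall i x y, U i x -> U i y -> mdist x y <= D i) ->
  (r%:E <= \sum_(0 <= i <oo)
    (if `[< exists2 z, U i z & mdist p z < r >] then 2 * D i else 0)%:E)%E.
Proof.
move=> cX rpq covU D0 UD; have [r0|r0] := leP r 0.
  apply: (@le_trans _ _ 0%E); first by rewrite lee_fin.
  by apply: nneseries_ge0 => i _ _; case: ifP => _; rewrite lee_fin// mulr_ge0.
have /choice[c cP] : forall i, exists z,
    `[< exists2 z, U i z & mdist p z < r >] -> U i z /\ mdist p z < r.
  move=> i; case: (pselect (exists2 z, U i z & mdist p z < r)) => [[z Uz pz]|].
    by exists z.
  by exists p => /asboolP.
pose J i : set R := if `[< exists2 z, U i z & mdist p z < r >] then
  [set` `[mdist p (c i) - D i, mdist p (c i) + D i]] else set0.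
have JE i : lebesgue_measure (J i) =
    (if `[< exists2 z, U i z & mdist p z < r >] then 2 * D i else 0)%:E.
  rewrite /J; case: ifP => _; last by rewrite measure0.
  rewrite lebesgue_measure_itv /= lte_fin; case: ifPn => [_|].
    by rewrite -EFinD; congr EFin; ring.
  by have := D0 i; rewrite -leNgt => *; congr EFin; lra.
under eq_eseriesr do rewrite -JE.
have -> : r%:E = lebesgue_measure [set` `[0, r[].
  by rewrite lebesgue_measure_itv /= lte_fin r0 oppr0 adde0.
apply: measure_sigma_subadditive => [i||t /=].
- by rewrite /J; case: ifP => _; [exact: measurable_itv|exact: measurable0].
- exact: measurable_itv.
rewrite in_itv /= => /andP[t0 tr].
have : connected (mdist p @` [set: X]).
  apply: connected_continuous_connected => //.
  apply: continuous_subspaceT => x; apply/cvgrPdist_lt => e e0.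
  apply/mdist_nbhsP; exists e => // y xy; apply: le_lt_trans xy.
  have := metric_triangle p x y; have := metric_triangle p y x.
  by rewrite (metric_sym y x) ler_norml => *; apply/andP; split; lra.
move=> /connected_intervalP ivl.
(* Connectedness makes the distance to [p] take every value between 0 and [mdist p q]. *)
have [z _ zt] : (mdist p @` [set: X]) t.
  apply: (ivl 0 (mdist p q)); [by exists p => //; rewrite mdistxx|by exists q|].
  by rewrite t0 ltW// (lt_le_trans tr).
have [i _ Uiz] := covU z I; exists i => //; rewrite /J.
have ex : exists2 z, U i z & mdist p z < r by exists z; rewrite ?zt.
rewrite (asboolT ex) /= in_itv /=.
have [Uc _] := cP i (asboolT ex).
have := UD i _ _ Uc Uiz; rewrite -zt.
have := metric_triangle p z (c i); have := metric_triangle p (c i) z.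
by rewrite (metric_sym z (c i)) => *; apply/andP; split; lra.
Qed.

(** Disjoint balls around the points of [s] each use up a share of the total length proportional to
    [r], since by connectedness [X] must leave each ball to reach another point. *)
Lemma finite_length_packing : connected [set: X] ->
  (hausdorff1 [set: X] < +oo)%E ->
  exists2 C : R, 0 <= C & forall (r : R) (s : seq X), 0 < r -> uniq s ->
    {in s &, forall x y, x != y -> r <= mdist x y} ->
    (size s)%:R <= 1 + C / r.
Proof.
move=> cX finX.
have [K HK] : exists K : R, (hausdorff1 [set: X] < K%:E)%E.
  case: (hausdorff1 [set: X]) finX => [h|//|] _; last by exists 0; rewrite ltNyr.
  by exists (h + 1); rewrite lte_fin ltrDl.
have K0 : 0 <= K.
  rewrite -lee_fin; apply: le_trans (ltW HK).
  apply: le_trans (hausdorff1_pre_le _ ltr01).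
  apply: le_ereal_inf_tmp => _ [U _ <-].
  by apply: nneseries_ge0 => i _ _; exact: diam_ge0.
(* The 8 combines the radius [r / 4] with the factor 2 of [length_cover_ball]. *)
exists (8 * K) => [|r s r0 us sep]; first by rewrite mulr_ge0.
(* With at most one point there is no second point outside the ball; the summand 1 of the bound
   covers this case. *)
have [s1|s1] := leqP (size s) 1.
  apply: (@le_trans _ _ 1); first by rewrite lern1.
  by rewrite lerDl divr_ge0 ?mulr_ge0// ltW.
have [U [covU Ud] UK] : exists2 U, [set: X] `<=` \bigcup_i U i /\
      (forall i, diam (U i) <= (r / 4)%:E)%E &
      (\sum_(0 <= i <oo) diam (U i) < K%:E)%E.
  have /ereal_inf_lt[_ [U ? <-] ?] : (hausdorff1_pre (r / 4) [set: X] < K%:E)%E.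
    by apply: le_lt_trans (hausdorff1_pre_le _ _) HK; lra.
  by exists U.
pose D i := fine (diam (U i)).
have DE i : (D i)%:E = diam (U i).
  by rewrite fineK// ge0_fin_numE ?diam_ge0// (le_lt_trans (Ud i))// ltry.
have D0 i : 0 <= D i by rewrite -lee_fin DE diam_ge0.
have Dr i : D i <= r / 4 by rewrite -lee_fin DE.
have UD i x y : U i x -> U i y -> mdist x y <= D i.
  by move=> Ux Uy; rewrite -lee_fin DE mdist_le_diam.
pose m i p := `[< exists2 z, U i z & mdist p z < r / 4 >].
have ball_le p : p \in s -> ((r / 4)%:E <=
    \sum_(0 <= i <oo) (if m i p then 2 * D i else 0)%:E)%E.
  move=> ps.
  have [q qs pq] : exists2 q, q \in s & p != q.
    have /allPn[q qs /= pq] : ~~ all (pred1 p) s.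
      apply: contraL s1 => /all_pred1P sp; rewrite -leqNgt.
      by move: us; rewrite sp; case: (size s) => [|[|n]] //=; rewrite inE eqxx.
    by exists q => //; rewrite eq_sym.
  apply: (length_cover_ball (q := q)) => //.
  by have := sep _ _ ps qs pq; lra.
(* A set of diameter at most [r / 4] meets at most one of the balls of radius
   [r / 4] around the points of [s]. *)
have : (((size s)%:R * (r / 4))%:E <= (2 * K)%:E)%E.
  have -> : ((size s)%:R * (r / 4))%:E = (\sum_(p <- s) (r / 4)%:E)%E.
    rewrite sumEFin; congr EFin.
    by rewrite big_const_seq count_predT iter_addr_0 mulr_natl.
  apply: (@le_trans _ _ (\sum_(p <- s) \sum_(0 <= i <oo)
      (if m i p then 2 * D i else 0)%:E)%E).
    by rewrite !big_seq; apply: lee_sum => p; exact: ball_le.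
  rewrite -nneseries_sum; last first.
    by move=> p i _; case: ifP => _; rewrite lee_fin// mulr_ge0.
  apply: (@le_trans _ _ (\sum_(0 <= i <oo) (2%:E * diam (U i)))%E).
    apply: lee_nneseries => [i _ _|i _].
      by apply: sume_ge0 => p _; case: ifP => _; rewrite lee_fin// mulr_ge0.
    rewrite -DE sumEFin lee_fin -big_mkcond/= -big_filter.
    rewrite big_const_seq count_predT iter_addr_0.
    rewrite -[leRHS]mulr1n ler_wpMn2l ?mulr_ge0//.
    have : uniq [seq p <- s | m i p] by rewrite filter_uniq.
    have : {in [seq p <- s | m i p] &, forall p q, p = q}.
      move=> p q; rewrite !mem_filter.
      move=> /andP[/asboolP[z Uz pz] ps] /andP[/asboolP[w Uw qw] qs].
      apply/eqP; apply: contraT => pq; have := sep _ _ ps qs pq.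
      have := metric_triangle p z q; have := metric_triangle z w q.
      have := UD _ _ _ Uz Uw; have := Dr i; rewrite (metric_sym w q).
      move=> *; suff : r < r by rewrite ltxx.
      by lra.
    case: [seq p <- s | m i p] => [|a [|b t]]//= ab.
    by rewrite inE (ab a b) ?inE ?eqxx ?orbT.
  rewrite nneseriesZl; last by move=> i _; exact: diam_ge0.
  by rewrite EFinM lee_wpmul2l ?lee_fin// ltW.
rewrite lee_fin => h.
apply: (@le_trans _ _ (8 * K / r)); last by rewrite lerDr.
by rewrite ler_pdivlMr//; lra.
Qed.

End packing.

(** * Upper limits of extended real sequences *)

Section limn_esup.
Context {R : realType}.
Implicit Types u v : nat -> \bar R.
Local Open Scope ereal_scope.

Lemma limn_esup_le_near u (c : \bar R) :
  (\forall n \near \oo, u n <= c) -> limn_esup u <= c.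
Proof.
move=> uc; rewrite /limn_esup limf_esupE.
apply: (@le_trans _ _ (ereal_sup (u @` [set n | u n <= c]))).
  by apply: ereal_inf_lbound; exists [set n | u n <= c].
by apply: ge_ereal_sup => _ [n ? <-].
Qed.

Lemma limn_esup_lt_near u (c : \bar R) :
  limn_esup u < c -> \forall n \near \oo, u n <= c.
Proof.
rewrite /limn_esup limf_esupE => /ereal_inf_lt[_ [V oV <-] Vc].
apply: filterS oV => n Vn; apply: le_trans (ltW Vc).
by apply: ereal_sup_ubound; exists n.
Qed.

Lemma le_limn_esup u v : (forall n, u n <= v n) -> limn_esup u <= limn_esup v.
Proof.
move=> uv; rewrite {2}/limn_esup limf_esupE; apply: le_ereal_inf_tmp.
move=> _ [V oV <-]; apply: limn_esup_le_near; apply: filterS oV => n Vn.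
by apply: le_trans (uv n) _; apply: ereal_sup_ubound; exists n.
Qed.

End limn_esup.

(** * Exponential form of the constants *)

Section exponential_bounds.
Context {R : realType}.

Lemma ln_plus_ge0 (x : R) : 0 <= ln_plus x.
Proof. by rewrite /ln_plus le_max lexx orbT. Qed.

Lemma max1_le_expR (x : R) : Num.max 1 x <= expR (ln_plus x).
Proof.
rewrite ge_max -{1}expR0 ler_expR ln_plus_ge0 /=.
have [x0|x0] := leP x 0; first exact: le_trans (ltW (expR_gt0 _)).
by rewrite -{1}(lnK x0) ler_expR /ln_plus le_max lexx.
Qed.

Lemma max1X_le_expR (x : R) n : Num.max 1 x ^+ n <= expR (n%:R * ln_plus x).
Proof.
rewrite expRM_natl lerXn2r ?nnegrE ?max1_le_expR ?expR_ge0//.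
by rewrite le_max ler01.
Qed.

End exponential_bounds.

(** * Growth of the number of visits outside [B] *)

Section visits.
Context {R : realType} {X : metricType R} {N : nat}.
Variables (A : 'I_N -> set X) (f : X -> X) (B : {set 'I_N}).

Lemma max_visits_outside_le n : (max_visits_outside A f B n <= n)%N.
Proof.
apply/bigmax_leqP => s _.
by apply: leq_trans (max_card _) _; rewrite card_ord.
Qed.

Lemma theta_ge0 : (0 <= theta A f B)%E.
Proof.
apply: limf_esup_ge0 => [[m _ mV]|n]; first exact: (mV m (leqnn m)).
by rewrite lee_fin divr_ge0.
Qed.

Lemma theta_le1 : (theta A f B <= 1)%E.
Proof.
apply: limn_esup_le_near; apply: nearW => -[|n].
  (* At [n = 0] the quotient is 0 by the convention [0^-1 = 0]. *)
  by rewrite invr0 mulr0 lee_fin.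
by rewrite lee_fin ler_pdivrMr ?ltr0n// mul1r ler_nat max_visits_outside_le.
Qed.

Lemma theta_fin_num : theta A f B \is a fin_num.
Proof.
by rewrite ge0_fin_numE ?theta_ge0// (le_lt_trans theta_le1)// ltry.
Qed.

(** From some rank [m] on, the count is at most [t * n]; before it, the count is at most [n], hence
    at most [m]. A bound valid for all [n] is needed because separation involves every iterate
    [k < n]. *)
Lemma max_visits_outside_affine (t : R) : (theta A f B < t%:E)%E ->
  exists m : nat, forall n, (max_visits_outside A f B n)%:R <= t * n%:R + m%:R.
Proof.
move=> thetat; have [m _ mP] := limn_esup_lt_near thetat.
have t0 : 0 <= t by rewrite -lee_fin (le_trans theta_ge0)// ltW.
exists m => n; have [mn|nm] := leqP m n.
  have := mP n mn; rewrite /= lee_fin; case: n mn => [|n] mn.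
    move=> _; apply: (@le_trans _ _ 0); last by rewrite mulr0 add0r.
    by rewrite lern0 -leqn0 max_visits_outside_le.
  rewrite ler_pdivrMr ?ltr0n// => /le_trans; apply.
  by rewrite lerDl.
apply: (@le_trans _ _ m%:R); last by rewrite lerDr mulr_ge0.
by rewrite ler_nat (leq_trans (max_visits_outside_le n))// ltnW.
Qed.

End visits.

(** * Separated sets and entropy *)

Section entropy.
Context {R : realType} {X : metricType R}.
Implicit Type f : X -> X.

Lemma max_separated_ge0 f n (e : R) : (0 <= max_separated f n e)%E.
Proof. by apply: ereal_sup_ubound; exists [::]. Qed.

Lemma le_max_separated f n (e1 e2 : R) : e1 <= e2 ->
  (max_separated f n e2 <= max_separated f n e1)%E.
Proof.
move=> e12; apply: ge_ereal_sup => _ [s [us sep] <-].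
apply: ereal_sup_ubound; exists s => //; split=> // x y xs ys xy.
exact: le_lt_trans (sep _ _ xs ys xy).
Qed.

Lemma le_lne_max_separated f n (e : R) (c : \bar R) :
  (max_separated f n e <= c)%E -> (lne (max_separated f n e) <= lne c)%E.
Proof.
move=> sc; rewrite lee_lne// in_itv /= leey andbT ?max_separated_ge0//.
by apply: le_trans sc; exact: max_separated_ge0.
Qed.

Lemma topological_entropy_le f (c : \bar R) :
  (forall e : R, 0 < e -> (limn_esup (fun n =>
    (lne (max_separated f n e) * (n%:R^-1)%:E)%E) <= c)%E) ->
  (topological_entropy f <= c)%E.
Proof.
move=> H; apply: lime_le; first last.
- by near=> e; apply: H; near: e; exact: nbhs_right_gt.
- apply: nonincreasing_at_right_is_cvge; apply: nearW => x e1 e2 _ _ e12.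
  apply: le_limn_esup => n.
  apply: lee_wpmul2r; first by rewrite lee_fin invr_ge0.
  exact: le_lne_max_separated (le_max_separated _ _ e12).
Unshelve. all: by end_near. Qed.

(** If the iterates are [M]-Lipschitz, points separated by [e] in the Bowen distance are at least
    [e / M] apart in [X], so the packing bound applies. *)
Lemma max_separated_lipschitz f : connected [set: X] ->
  (hausdorff1 [set: X] < +oo)%E ->
  exists2 C : R, 0 <= C & forall n (e M : R), 0 < e -> 1 <= M ->
    (forall k x y, (k < n)%N ->
      mdist (iter k f x) (iter k f y) <= M * mdist x y) ->
    (max_separated f n e <= ((1 + C / e) * M)%:E)%E.
Proof.
move=> cX finX; have [C C0 CP] := finite_length_packing cX finX.
exists C => // n e M e0 M1 fM; have M0 : 0 < M by lra.
apply: ge_ereal_sup => _ [s [us sep] <-]; rewrite lee_fin.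
apply: (@le_trans _ _ (1 + C / (e / M))).
  apply: CP => //; first by rewrite divr_gt0.
  move=> x y xs ys xy; rewrite ler_pdivrMr// mulrC.
  apply: le_trans (ltW (sep _ _ xs ys xy)) _.
  apply: bigmax_le => [|k _]; last exact: fM.
  by rewrite mulr_ge0 ?mdist_ge0// ltW.
(* Here [1 <= M] absorbs the summand 1 into the product. *)
by rewrite mulrDl mul1r invfM invrK mulrA lerD2r.
Qed.

End entropy.

Theorem proposition12 (R : realType) (X : metricType R)
    (X_continuum : continuum [set: X])
    (X_nondegenerate : nondegenerate_set [set: X])
    (X_totally_regular : totally_regular X)
    (X_convex : convex_metric X)
    (X_finite_length : (hausdorff1 [set: X] < +oo)%E)
    (N : nat) (A : 'I_N -> set X) (L : 'I_N -> R)
    (P : set X) (f : X -> X) (f_Lipschitz : P_Lipschitz A f P L)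
    (B : {set 'I_N}) (B_nonempty : B != finset.set0) :
  (topological_entropy f <=
    (ln_plus (max_const L B))%:E +
    2%:E * theta A f B * (ln_plus (max_const L [set: 'I_N]%SET))%:E)%E.
Proof.
have [_ cptX cX] := X_continuum.
set b := ln_plus (max_const L B); set a := ln_plus _.
have b0 : 0 <= b := ln_plus_ge0 _; have a0 : 0 <= a := ln_plus_ge0 _.
pose th := fine (theta A f B).
have thE : theta A f B = th%:E by rewrite /th fineK ?theta_fin_num.
have th0 : 0 <= th by rewrite -lee_fin -thE theta_ge0.
(* The bound is proved with [th] in place of [2 * th], which suffices as [th * a] is nonnegative. *)
apply: (@le_trans _ _ (b + th * a)%:E); last first.
  rewrite thE -!EFinM -EFinD lee_fin.
  by have : 0 <= th * a by [exact: mulr_ge0]; lra.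
apply: topological_entropy_le => e e0.
apply/lee_addgt0Pr => eta eta0; rewrite -EFinD.
(* The error [d * (a + 1)] has two sources: [d * a] from replacing [th] by [th + d], and [d] from
   the terms bounded in [n]. *)
pose d := eta / (a + 1).
have d0 : 0 < d by rewrite divr_gt0// ltr_wpDl.
have dE : d * (a + 1) = eta by rewrite divfK// gt_eqF// ltr_wpDl.
have [|m mP] := @max_visits_outside_affine R X N A f B (th + d).
  by rewrite thE lte_fin ltrDl.
(* [expR (G n)] bounds the Lipschitz constants of all iterates [k < n] simultaneously, since the
   affine bound increases with [k]. *)
pose G n : R := n%:R * b + ((th + d) * n%:R + m%:R) * a.
have G0 n : 0 <= G n.
  by rewrite addr_ge0// mulr_ge0// addr_ge0// mulr_ge0// addr_ge0// ltW.
have fG n k x y : (k < n)%N ->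
    mdist (iter k f x) (iter k f y) <= expR (G n) * mdist x y.
  move=> kn.
  apply: le_trans (iter_lipschitz cptX X_convex f_Lipschitz B k x y) _.
  apply: ler_wpM2r; first exact: mdist_ge0.
  rewrite /itinerary_const.
  apply: (@le_trans _ _ (expR (k%:R * b) *
      expR ((max_visits_outside A f B k)%:R * a))).
    by rewrite ler_pM ?exprn_ge0 ?le_max ?ler01 ?max1X_le_expR.
  rewrite -expRD ler_expR.
  have kn' : k%:R <= n%:R :> R by rewrite ler_nat ltnW.
  apply: lerD; first by rewrite ler_wpM2r.
  rewrite ler_wpM2r//; apply: le_trans (mP k) _.
  by rewrite lerD2r ler_wpM2l// addr_ge0// ltW.
have [C C0 CP] := max_separated_lipschitz f cX X_finite_length.
have Ce0 : 0 < 1 + C / e by rewrite ltr_pwDl// divr_ge0// ltW.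
have sepG n : (lne (max_separated f n e) <= (ln (1 + C / e) + G n)%:E)%E.
  rewrite -[G n in leRHS]expRK -lnM ?posrE ?expR_gt0//.
  rewrite -lne_EFin ?mulr_gt0 ?expR_gt0//.
  apply: le_lne_max_separated; apply: CP => //; last exact: fG.
  by rewrite -expR0 ler_expR.
apply: limn_esup_le_near.
(* [c] collects the terms independent of [n]; it is eventually below [d * n]. *)
pose c := ln (1 + C / e) + m%:R * a.
near=> n.
have n0 : 0 < n%:R :> R by rewrite ltr0n; near: n; exact: nbhs_infty_gt.
have cn : c <= d * n%:R.
  by rewrite mulrC -ler_pdivrMr//; near: n; exact: nbhs_infty_ger.
apply: (@le_trans _ _ ((ln (1 + C / e) + G n)%:E * (n%:R^-1)%:E)%E).
  by rewrite lee_wpmul2r// lee_fin invr_ge0 ltW.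
rewrite -EFinM lee_fin ler_pdivrMr// -dE.
by rewrite /c in cn; rewrite /G; nra.
Unshelve. all: by end_near. Qed.
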